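(* Let $(\mathcal{S},\mathcal{A},p,\gamma)$ be a reward-free MDP, $r_E$ the expert's reward function, $\alpha>0$ the temperature, $A^*$ the optimal maximum-entropy advantage function for $r_E$, and $\pi^*$ the optimal maximum-entropy policy for $r_E$. Let $k\ge 1$ be the segment length. Suppose that preferences are generated by the noisy rational regret-preference model with advantage $A^*$, i.e. for a pair of segments $(\sigma^1,\sigma^0)$ of length $k$ the expert prefers $\sigma^1$ to $\sigma^0$ with probability $$P_{A^*}[\sigma^1\succ\sigma^0]=\frac{\exp\sum_{\sigma^1}\gamma^tA^*(s^1_t,a^1_t)}{\exp\sum_{\sigma^1}\gamma^tA^*(s^1_t,a^1_t)+\exp\sum_{\sigma^0}\gamma^tA^*(s^0_t,a^0_t)},$$ and that the number of preferences is unbounded (in the sense of the infinite-data limit described in the context). Then CPL recovers the optimal policy: every minimizer $\hat\pi$, over all policies, of the CPL loss $$\mathcal{L}_{\mathrm{CPL}}(\pi)=\mathbb{E}\left[-\log\frac{\exp\sum_{\sigma^+}\gamma^t\alpha\log\pi(a^+_t|s^+_t)}{\exp\sum_{\sigma^+}\gamma^t\alpha\log\pi(a^+_t|s^+_t)+\exp\sum_{\sigma^-}\gamma^t\alpha\log\pi(a^-_t|s^-_t)}\right]$$ equals $\pi^*$ (almost everywhere with respect to the reference measure $ds\otimes da$ on $\mathcal{S}\times\mathcal{A}$; in particular at every $(s,a)$ when $\mathcal{S}$ and $\mathcal{A}$ are finite with counting measures).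
   Context: A reward-free MDP $(\mathcal{S},\mathcal{A},p,\gamma)$ consists of a state space $\mathcal{S}$, an action space $\mathcal{A}$, each with a $\sigma$-finite reference measure $ds$, $da$ (counting measure in the finite case), a transition kernel $p(\cdot|s,a)$ on $\mathcal{S}$, and a discount factor $\gamma\in(0,1)$. A policy is a measurable $\pi:\mathcal{S}\times\mathcal{A}\to(0,\infty)$ with $\int_{\mathcal{A}}\pi(a|s)\,da=1$ for all $s$; positivity is required so that $\log\pi$ is real-valued. Maximum-entropy setting with temperature $\alpha>0$: for a reward function $r$, the optimal policy maximizes $\mathbb{E}_\pi[\sum_{t\ge0}\gamma^t(r(s_t,a_t)-\alpha\log\pi(a_t|s_t))]$ from every initial state. $V^*_r(s)$ is the optimal value from $s$, $Q^*_r(s,a)=r(s,a)+\gamma\,\mathbb{E}_{s'\sim p(\cdot|s,a)}[V^*_r(s')]$, and $A^*_r=Q^*_r-V^*_r$. The known relation (Ziebart) is that $\pi^*_r(a|s)=e^{A^*_r(s,a)/\alpha}$, so in particular $\int_{\mathcal{A}}e^{A^*_r(s,a)/\alpha}\,da=1$ for all $s$; it is assumed that $r_E$ is such that these objects exist, are finite, and satisfy this relation. Write $A^*=A^*_{r_E}$, $\pi^*=\pi^*_{r_E}$. A segment of length $k$ is $\sigma=(s_1,a_1,\dots,s_k,a_k)$, and $\sum_\sigma\gamma^tf(s_t,a_t)$ denotes $\sum_{t=1}^k\gamma^tf(s_t,a_t)$. Infinite-data limit: let $\nu$ be the measure $ds_1\,da_1\,p(ds_2|s_1,a_1)\,da_2\cdots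 p(ds_k|s_{k-1},a_{k-1})\,da_k$ on segments of length $k$. The pair $(\sigma^1,\sigma^0)$ is drawn from a probability distribution that is mutually absolutely continuous with $\nu\otimes\nu$ (in the finite case: every pair of dynamically feasible segments has positive probability and no other pair does). Given the pair, the label is drawn from $P_{A^*}$: $(\sigma^+,\sigma^-)=(\sigma^1,\sigma^0)$ with probability $P_{A^*}[\sigma^1\succ\sigma^0]$ and $(\sigma^+,\sigma^-)=(\sigma^0,\sigma^1)$ otherwise. The expectation in $\mathcal{L}_{\mathrm{CPL}}$ is over this joint law. Sufficient representation power is assumed, i.e. the minimization is over all policies. *)

(* Defs.v *)
From HB Require Import structures.
From mathcomp Require Export all_boot all_order all_algebra.
From mathcomp Require Export all_classical all_reals all_analysis.

Set Implicit Arguments.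
Unset Strict Implicit.
Unset Printing Implicit Defensive.
Import Order.TTheory GRing.Theory Num.Theory.
Import numFieldNormedType.Exports.

Local Open Scope classical_set_scope.
Local Open Scope ring_scope.
Local Open Scope ereal_scope.

Section mdp.
Context (dS dA : measure_display) (S : measurableType dS)
  (A : measurableType dA) (R : realType).
Implicit Types (p : R.-pker (S * A) ~> S) (pi f r : S * A -> R).

(* A segment (s_1, a_1, ..., s_n, a_n) is a tuple of state-action pairs, whose
   i-th component, i < n, is (s_{i+1}, a_{i+1}).
   [seg_law q p ini n] is the measure
     ini(ds_1) q(s_1, da_1) p(ds_2 | s_1, a_1) ... p(ds_n | ..) q(s_n, da_n)
   where the action measure q is not required to be finite. *)
Fixpoint seg_law (q : S -> set A -> \bar R) p (ini : set S -> \bar R) (n : nat)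
    : set (n.-tuple (S * A)) -> \bar R :=
  match n with
  | 0 => fun B => \d_[tuple] B
  | m.+1 => fun B => \int[ini]_s \int[q s]_a
      seg_law q p (p (s, a))
        [set sigma : m.-tuple (S * A) | B [tuple of (s, a) :: sigma]]
  end.

(* ds_1 da_1 p(ds_2 | s_1, a_1) da_2 ... p(ds_n | s_{n-1}, a_{n-1}) da_n *)
Definition seg_ref (muS : set S -> \bar R) (muA : set A -> \bar R) p (n : nat) :
    set (n.-tuple (S * A)) -> \bar R :=
  seg_law (fun=> muA) p muS (n := n).

Definition is_policy (muA : set A -> \bar R) pi : Prop :=
  [/\ measurable_fun [set: S * A] pi,
      forall x, (0 < pi x)%R &
      forall s, \int[muA]_a (pi (s, a))%:E = 1].

(* pi(a|s) da *)
Definition policy_law (muA : set A -> \bar R) pi (s : S) (B : set A) : \bar R :=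
  \int[muA]_(a in B) (pi (s, a))%:E.

(* Infinite trajectories (s_0, a_0, s_1, a_1, ...), with the sigma-algebra
   generated by the coordinates. *)
Definition trajectory := g_sigma_algebraType
  [set C : set (nat -> S * A) | exists t (B : set (S * A)),
    measurable B /\ C = [set w | B (w t)]].

(* P is the law of the trajectory started in s that follows pi: its
   finite-dimensional marginals determine it. *)
Definition is_trajectory_law (muA : set A -> \bar R) p pi (s : S)
    (P : probability trajectory R) : Prop :=
  forall (n : nat) (B : set (n.-tuple (S * A))), measurable B ->
    P [set w | B [tuple w (i : nat) | i < n]] =
    seg_law (policy_law muA pi) p \d_s B.

Definition soft_return_upto (gamma alpha : R) r pi (w : trajectory) (n : nat) :
    \bar R :=
  (\sum_(0 <= t < n) gamma ^+ t * (r (w t) - alpha * ln (pi (w t))))%R%:E.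

Definition soft_return (gamma alpha : R) r pi (w : trajectory) : \bar R :=
  limn (soft_return_upto gamma alpha r pi w).

(* v = E_pi[sum_t gamma^t (r(s_t, a_t) - alpha log pi(a_t|s_t)) | s_0 = s], this
   expectation being well defined in [-oo, +oo]: the series converges in
   [-oo, +oo] almost surely, and its positive or its negative part is
   integrable. *)
Definition has_value (muA : set A -> \bar R) p (gamma alpha : R) r pi (s : S)
    (v : \bar R) : Prop :=
  exists P : probability trajectory R,
    [/\ is_trajectory_law muA p pi s P,
        {ae P, forall w, cvgn (soft_return_upto gamma alpha r pi w)},
        \int[P]_w (soft_return gamma alpha r pi)^\+ w < +oo \/
          \int[P]_w (soft_return gamma alpha r pi)^\- w < +oo &
        v = \int[P]_w soft_return gamma alpha r pi w].

Definition opt_value (muA : set A -> \bar R) p (gamma alpha : R) r (s : S) :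
    \bar R :=
  ereal_sup [set v | exists pi,
    is_policy muA pi /\ has_value muA p gamma alpha r pi s v].

Definition opt_qvalue (muA : set A -> \bar R) p (gamma alpha : R) r
    (x : S * A) : \bar R :=
  (r x)%:E + gamma%:E * \int[p x]_s opt_value muA p gamma alpha r s.

(* Meaningful when the optimal values are finite. *)
Definition opt_advantage (muA : set A -> \bar R) p (gamma alpha : R) r
    (x : S * A) : R :=
  fine (opt_qvalue muA p gamma alpha r x - opt_value muA p gamma alpha r x.1).

Definition is_optimal_policy (muA : set A -> \bar R) p (gamma alpha : R) r pi :
    Prop :=
  is_policy muA pi /\
  forall s, has_value muA p gamma alpha r pi s
              (opt_value muA p gamma alpha r s).

(* sum_{t = 1}^k gamma^t f(s_t, a_t) *)
Definition seg_sum (gamma : R) f (k : nat) (sigma : k.-tuple (S * A)) : R :=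
  (\sum_(i < k) gamma ^+ i.+1 * f (tnth sigma i))%R.

(* P_f[sigma1 > sigma0] *)
Definition pref_prob (gamma : R) f (k : nat) (sigma1 sigma0 : k.-tuple (S * A)) :
    R :=
  (expR (seg_sum gamma f sigma1) /
   (expR (seg_sum gamma f sigma1) + expR (seg_sum gamma f sigma0)))%R.

(* (sigma^1, sigma^0) = z is drawn from rho and then, given z, the label y from
   the Bernoulli distribution of parameter P_adv[sigma^1 > sigma^0]; y = true
   means (sigma^+, sigma^-) = (sigma^1, sigma^0). *)
Definition cpl_loss (gamma alpha : R) (k : nat) (adv : S * A -> R)
    (rho : probability (k.-tuple (S * A) * k.-tuple (S * A))%type R) pi :
    \bar R :=
  \int[rho]_z \int[bernoulli_prob (pref_prob gamma adv z.1 z.2)]_y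
    let: (sigmap, sigmam) := if y then (z.1, z.2) else (z.2, z.1) in
    (- ln (pref_prob gamma (fun x => (alpha * ln (pi x))%R) sigmap sigmam))%:E.

Definition is_minimizer (muA : set A -> \bar R) (L : (S * A -> R) -> \bar R)
    pi : Prop :=
  is_policy muA pi /\ forall pi', is_policy muA pi' -> L pi <= L pi'.

End mdp.

Arguments seg_law {dS dA S A R} q p ini n _.
Arguments seg_ref {dS dA S A R} muS muA p n _.

(* Main.v *)
Require Import Defs.
From HB Require Import structures.
From mathcomp Require Import measurable_realfun.
From mathcomp Require Import ring lra.
From mathcomp Require finmap.

(* Since [alpha ln pistar] is the optimal advantage, the loss of [pistar] is the
   expected entropy of the labels, which is finite, and the loss of any policy
   is an expected cross entropy. By Gibbs' inequality a minimizer [pihat]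
   therefore induces the preference probabilities of [pistar] almost surely, so
   the discounted sums of [f := alpha ln pihat - alpha ln pistar] along two
   segments agree almost everywhere, hence [seg_sum gamma f] is a.e. equal to
   some constant [c]. Conditioning on the first pair [(s, a)], the discounted
   sum along the rest of the segment is constant too; by induction on the length
   this constant vanishes, so [f(s, .) = c / gamma] a.e. As [pihat(.|s)] and
   [pistar(.|s)] both integrate to 1, [c = 0] and [f = 0] a.e. *)

Set Implicit Arguments.
Unset Strict Implicit.
Unset Printing Implicit Defensive.
Import Order.TTheory GRing.Theory Num.Theory.
Import numFieldNormedType.Exports.

Local Open Scope classical_set_scope.
Local Open Scope ring_scope.
Local Open Scope ereal_scope.

(** * Null sets from vanishing integrals *)

Lemma ge0_integral_eq0_ae d (T : measurableType d) (R : realType)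
    (mu : {measure set T -> \bar R}) (f : T -> \bar R) :
  measurable_fun [set: T] f -> (forall x, 0 <= f x) ->
  \int[mu]_x f x = 0 -> {ae mu, forall x, f x = 0}.
Proof.
move=> mf f0 if0; have [/(_ _)+ _] := ae_eq_integral_abs mu measurableT mf.
under eq_integral do rewrite gee0_abs//.
by move=> /(_ if0); apply: filterS => x /(_ I).
Qed.

Lemma measurable_neq d (T : measurableType d) (R : realType) (f g : T -> R) :
  measurable_fun [set: T] f -> measurable_fun [set: T] g ->
  measurable [set x | f x != g x].
Proof.
move=> mf mg; rewrite (_ : mkset _ =
    [set: T] `&` (fun x => f x - g x)%R @^-1` (~` [set 0%R])); last first.
  by rewrite setTI; apply/seteqP; split => x; rewrite /= -subr_eq0 => /eqP.
apply: measurable_funB => //; apply: measurableC; exact: measurable_set1.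
Qed.

Lemma ae_xsection0_product_measure1 d1 d2 (T1 : measurableType d1)
    (T2 : measurableType d2) (R : realType)
    (m1 : {sigma_finite_measure set T1 -> \bar R})
    (m2 : {sigma_finite_measure set T2 -> \bar R}) (N : set (T1 * T2)) :
  measurable N -> {ae m1, forall x, m2 (xsection N x) = 0} ->
  (m1 \x m2) N = 0.
Proof.
move=> mN N0; rewrite /product_measure1.
rewrite (@ge0_ae_eq_integral _ _ _ m1 _ _ (cst 0)) ?integral0//.
  exact: measurable_fun_xsection.
by apply: filterS N0 => x + _.
Qed.

(** * Pulling a probability kernel back along a measurable map *)

Section kernel_reindex.
Context d d1 d2 (Y : measurableType d) (X : measurableType d1)
  (S : measurableType d2) (R : realType).
Variables (p : R.-pker X ~> S) (h : Y -> X) (mh : measurable_fun [set: Y] h).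

Definition kreindex of measurable_fun [set: Y] h :
  Y -> {measure set S -> \bar R} := fun y => p (h y).

Let measurable_kreindex U : measurable U ->
  measurable_fun [set: Y] (kreindex mh ^~ U).
Proof.
move=> mU; apply: (measurableT_comp (f := p ^~ U)) => //.
exact: measurable_kernel.
Qed.

HB.instance Definition _ :=
  isKernel.Build _ _ Y S R (kreindex mh) measurable_kreindex.

Let kreindex_setT y : kreindex mh y [set: S] = 1.
Proof. exact: prob_kernel. Qed.

HB.instance Definition _ :=
  Kernel_isProbability.Build _ _ Y S R (kreindex mh) kreindex_setT.

End kernel_reindex.

(** * The segment law as a measure, measurable in its parameters *)

Section seg_law_measure.
Context (dS dA : measure_display) (S : measurableType dS)
  (A : measurableType dA) (R : realType).
Variables (muA : {sigma_finite_measure set A -> \bar R})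
  (p : R.-pker (S * A) ~> S).

Local Notation law := (seg_law (fun=> (muA : set A -> \bar R)) p).

Lemma seg_law_ge0 n (ini : {measure set S -> \bar R}) B : 0 <= law ini n B.
Proof.
elim: n ini B => [|n IHn] ini B //=.
by apply: integral_ge0 => s _; apply: integral_ge0 => a _; exact: IHn.
Qed.

(** The property of the law of the first state that keeps the recursion measurable. It is isolated
    because it is met in two ways: by a probability kernel pulled back along a map, and by a
    constant sigma-finite measure. *)
Definition measurable_integration d (Y : measurableType d)
    (l : Y -> {measure set S -> \bar R}) :=
  forall f : Y * S -> \bar R, (forall z, 0 <= f z) ->
    measurable_fun [set: Y * S] f ->
    measurable_fun [set: Y] (fun y => \int[l y]_s f (y, s)).

(** The parameter space [Y] is arbitrary because each step of the induction on [n] turns the first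
    state and action into parameters. *)
Let seg_law_measurable n := forall d (Y : measurableType d) (h : Y -> S * A)
    (B : set (Y * n.-tuple (S * A))),
  measurable_fun [set: Y] h -> measurable B ->
  measurable_fun [set: Y] (fun y => law (p (h y)) n (xsection B y)).

Lemma measurable_seg_lawS n d (Y : measurableType d)
    (l : Y -> {measure set S -> \bar R}) (B : set (Y * n.+1.-tuple (S * A))) :
  seg_law_measurable n -> measurable_integration l -> measurable B ->
  measurable_fun [set: Y] (fun y => law (l y) n.+1 (xsection B y)).
Proof.
move=> IHn ml mB.
(* [g] moves the state and action among the parameters back to the head of the segment, so that
   sections of the preimage of [B] are the slices in [seg_law]. *)
pose g (w : (Y * S * A) * n.-tuple (S * A)) :=
  (w.1.1.1, [the n.+1.-tuple (S * A)%type of (w.1.1.2, w.1.2) :: w.2]).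
have mg : measurable_fun [set: _] g.
  apply: measurable_fun_pair.
    by do 2 apply: measurableT_comp => //; exact: measurable_fst.
  apply: measurable_cons => //.
  apply: measurable_fun_pair.
    by do 2 apply: measurableT_comp => //.
  exact: measurableT_comp.
pose F (z : Y * S * A) := law (p (z.1.2, z.2)) n (xsection (g @^-1` B) z).
have mF : measurable_fun [set: _] F.
  apply: (IHn _ _ (fun z : Y * S * A => (z.1.2, z.2))).
    by apply: measurable_fun_pair => //; exact: measurableT_comp.
  by rewrite -[X in measurable X]setTI; exact: mg.
have F0 z : 0 <= F z by exact: seg_law_ge0.
pose G (z : Y * S) := \int[muA]_a F (z, a).
have mG : measurable_fun [set: Y * S] G.
  exact: (measurable_fun_fubini_tonelli_F (m2 := muA) F mF F0).
have G0 z : 0 <= G z by apply: integral_ge0 => a _; exact: F0.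
exact: ml G G0 mG.
Qed.

Lemma measurable_seg_law n : seg_law_measurable n.
Proof.
elim: n => [|n IHn] d Y h B mh mB.
  have mg : measurable_fun [set: Y] (fun y => (y, [tuple] : 0.-tuple (S * A))).
    exact: measurable_fun_pair.
  have mf := measurableT_comp (measurable_indic (R := R) mB) mg.
  move/measurable_EFinP : mf; congr measurable_fun.
  apply/funext => y; rewrite /= diracE indicE.
  by rewrite mem_xsection.
apply: measurable_seg_lawS => // f f0 mf.
exact: (measurable_fun_integral_finite_kernel f (kreindex p mh)).
Qed.


Lemma measurable_cons_slice n (B : set (n.+1.-tuple (S * A))) x :
  measurable B -> measurable [set sigma : n.-tuple _ | B [tuple of x :: sigma]].
Proof.
move=> mB; rewrite -[X in measurable X]setTI.
apply: (measurable_cons (f := cst x) (g := id)) => //.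
Qed.

Lemma measurable_seg_law_slice n (B : set (n.+1.-tuple (S * A))) :
  measurable B -> measurable_fun [set: S * A] (fun x =>
    law (p x) n [set sigma : n.-tuple _ | B [tuple of x :: sigma]]).
Proof.
move=> mB.
pose g (w : (S * A) * n.-tuple (S * A)) :=
  [the n.+1.-tuple (S * A)%type of w.1 :: w.2].
have mg : measurable_fun [set: _] g by exact: measurable_cons.
have mgB : measurable (g @^-1` B).
  by rewrite -[X in measurable X]setTI; exact: mg.
have := measurable_seg_law (@measurable_id _ _ _) mgB.
congr measurable_fun; apply/funext => x; congr (seg_law _ _ _ _ _).
by apply/seteqP; split => sigma; rewrite /xsection /= inE.
Qed.

Lemma measurable_integral_seg_law n (B : set (n.+1.-tuple (S * A))) :
  measurable B -> measurable_fun [set: S] (fun s => \int[muA]_a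
    law (p (s, a)) n [set sigma : n.-tuple _ | B [tuple of (s, a) :: sigma]]).
Proof.
move=> mB; apply: (measurable_fun_fubini_tonelli_F (m2 := muA) (fun x =>
  law (p x) n [set sigma : n.-tuple _ | B [tuple of x :: sigma]])) => [|x].
  exact: measurable_seg_law_slice.
exact: seg_law_ge0.
Qed.

(** By induction on [n]: monotone convergence takes the series out of the action integral, then out
    of the state integral. *)
Lemma seg_law_bigcup n (ini : {measure set S -> \bar R}) F :
  (forall i, measurable (F i)) -> trivIset [set: nat] F ->
  law ini n (\bigcup_i F i) = \sum_(i <oo) law ini n (F i).
Proof.
elim: n ini F => [|n IHn] ini F mF tF.
  by apply/esym/cvg_lim => //; apply: measure_semi_sigma_additive => //;
    exact: bigcupT_measurable.
pose F' i x := [set sigma : n.-tuple (S * A) | F i [tuple of x :: sigma]].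
transitivity (\int[ini]_s \int[muA]_a
    \sum_(i <oo) law (p (s, a)) n (F' i (s, a))).
  apply: eq_integral => s _; apply: eq_integral => a _.
  rewrite -IHn => [|i|].
  - congr (seg_law _ _ _ _ _).
  - exact: measurable_cons_slice.
  - apply/trivIsetP => i j _ _ ij; apply/seteqP; split => // sigma [/= Fi Fj].
    move/trivIsetP : tF => /(_ i j I I ij) /seteqP[+ _].
    by apply; split; eassumption.
transitivity (\int[ini]_s
    \sum_(i <oo) \int[muA]_a law (p (s, a)) n (F' i (s, a))).
  apply: eq_integral => s _; rewrite integral_nneseries// => [i|i a _].
    apply: (@measurable_fun_pair2 _ _ _ _ _ _ (fun x => law (p x) n (F' i x))).
    exact: measurable_seg_law_slice.
  exact: seg_law_ge0.
rewrite integral_nneseries// => [i|i s _].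
  exact: measurable_integral_seg_law.
by apply: integral_ge0 => a _; exact: seg_law_ge0.
Qed.

Section seg_measure.
Variables (ini : {measure set S -> \bar R}) (n : nat).

Definition seg_measure := law ini n.

Let seg_measure0 : seg_measure set0 = 0.
Proof.
rewrite /seg_measure; elim: n ini => [|m IHm] mu /=; first exact: measure0.
by rewrite integral0_eq// => s _; rewrite integral0_eq.
Qed.

Let seg_measure_ge0 B : 0 <= seg_measure B.
Proof. exact: seg_law_ge0. Qed.

Let seg_measure_sigma_additive : semi_sigma_additive seg_measure.
Proof.
move=> F mF tF mUF; rewrite /seg_measure seg_law_bigcup//.
by apply: is_cvg_nneseries => i _ _; exact: seg_law_ge0.
Qed.

HB.instance Definition _ := isMeasure.Build _ _ _ seg_measure
  seg_measure0 seg_measure_ge0 seg_measure_sigma_additive.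

End seg_measure.

End seg_law_measure.

(** * Discounted sums that are almost everywhere constant *)

Section seg_sum_theory.
Context (dS dA : measure_display) (S : measurableType dS)
  (A : measurableType dA) (R : realType).
Variables (gamma : R) (f : S * A -> R).

(** The weights start at [gamma ^+ 1], so the first term carries a factor [gamma] too; hence the
    quotients by [gamma] below. *)
Lemma seg_sum_cons n x (sigma : n.-tuple (S * A)) :
  seg_sum gamma f [tuple of x :: sigma] =
  (gamma * (f x + seg_sum gamma f sigma))%R.
Proof.
rewrite /seg_sum big_ord_recl expr1 tnth0 mulrDr; congr (_ + _)%R.
rewrite mulr_sumr; apply: eq_bigr => i _.
by rewrite tnthS exprS mulrA.
Qed.

Hypothesis mf : measurable_fun [set: S * A] f.

Lemma measurable_seg_sum n :
  measurable_fun [set: n.-tuple (S * A)] (seg_sum gamma f (k := n)).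
Proof.
apply: measurable_sum => i; apply: measurable_funM => //.
apply: (measurableT_comp (f := f) (g := fun s : n.-tuple _ => tnth s i)) => //.
exact: measurable_tnth.
Qed.

Variables (muA : {sigma_finite_measure set A -> \bar R})
  (p : R.-pker (S * A) ~> S).
Hypothesis gamma0 : (gamma != 0)%R.
(** For the scaled log ratio of two policies this follows from their normalization over the
    actions. *)
Hypothesis ae_cst_eq0 :
  forall s c, {ae muA, forall a, f (s, a) = c} -> c = 0%R.

Local Notation law := (seg_law (fun=> (muA : set A -> \bar R)) p).

Lemma measurable_seg_sum_neq n (c : R) :
  measurable [set sigma : n.-tuple (S * A) | seg_sum gamma f sigma != c].
Proof.
by apply: measurable_neq => //; exact: measurable_seg_sum.
Qed.

(** Both outer integrals in the law of the exceptional set have nonnegative integrands, so they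
    vanish only if almost every slice is null. The premise on length [n] is the induction hypothesis
    of [seg_sum_ae_cst]. *)
Let seg_sum_ae_cstS n (ini : {measure set S -> \bar R}) c :
  (forall (nu : {measure set S -> \bar R}) c', nu [set: S] != 0 ->
    law nu n [set sigma | seg_sum gamma f sigma != c'] = 0 -> c' = 0%R) ->
  law ini n.+1 [set sigma | seg_sum gamma f sigma != c] = 0 ->
  {ae ini, forall s, {ae muA, forall a, f (s, a) = (c / gamma)%R}}.
Proof.
move=> IHn /= law0.
have mB := measurable_seg_sum_neq (n := n.+1) c.
have := ge0_integral_eq0_ae (measurable_integral_seg_law muA p mB) _ law0.
have H s : 0 <= \int[muA]_a law (p (s, a)) n
    [set sigma : n.-tuple _ | seg_sum gamma f [tuple of (s, a) :: sigma] != c].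
  by apply: integral_ge0 => a _; exact: seg_law_ge0.
move=> /(_ H); apply: filterS => s law0s.
have mBs : measurable_fun [set: A] (fun a => law (p (s, a)) n
    [set sigma : n.-tuple _ | seg_sum gamma f [tuple of (s, a) :: sigma] != c]).
  exact: measurable_fun_pair2 (measurable_seg_law_slice muA p mB).
have := ge0_integral_eq0_ae mBs _ law0s.
have {}H a : 0 <= law (p (s, a)) n
    [set sigma : n.-tuple _ | seg_sum gamma f [tuple of (s, a) :: sigma] != c].
  exact: seg_law_ge0.
move=> /(_ H); apply: filterS => a law0a.
(* The constant for the tail is [c / gamma - f (s, a)]; the initial measure [p (s, a)] is nonzero,
   being a probability. *)
apply/esym/eqP; rewrite -subr_eq0; apply/eqP.
apply: (IHn (p (s, a))); first by rewrite prob_kernel onee_eq0.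
rewrite -[RHS]law0a; congr (seg_law _ _ _ _ _); apply/funext => sigma /=.
rewrite seg_sum_cons; congr (is_true (~~ _)).
rewrite eq_sym subr_eq [X in _ = (X == _)]mulrC.
rewrite -[X in _ = (_ == X)](divfK gamma0).
by rewrite (inj_eq (mulIf gamma0)) eq_sym addrC.
Qed.

Lemma seg_sum_ae_cst n (ini : {measure set S -> \bar R}) c :
  ini [set: S] != 0 ->
  law ini n [set sigma | seg_sum gamma f sigma != c] = 0 -> c = 0%R.
Proof.
elim: n ini c => [|n IHn] ini c ini0.
  (* The empty sum is 0 and the law of the empty segment is a Dirac mass, so [c != 0] would give the
     exceptional set mass 1. *)
  move=> /eqP; apply: contraTeq => cN0.
  by rewrite /= diracE mem_set ?onee_neq0//= /seg_sum big_ord0 eq_sym.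
(* If [c] were nonzero, so would be [c / gamma], against [ae_cst_eq0] at almost every [s]; all of
   [S] would then be null. *)
move=> /(seg_sum_ae_cstS IHn) fc; apply/eqP; apply: contra_neqT ini0 => c0.
have [N [mN N0 subN]] : {ae ini, forall s, False}.
  apply: filterS fc => s /ae_cst_eq0 /eqP.
  by rewrite mulf_eq0 invr_eq0 (negbTE c0) (negbTE gamma0).
by rewrite (_ : [set: S] = N)//; apply/seteqP; split => // s _; exact: subN.
Qed.

Lemma seg_sum_ae_cst_eq0 n (ini : {measure set S -> \bar R}) c :
  law ini n.+1 [set sigma | seg_sum gamma f sigma != c] = 0 ->
  {ae ini, forall s, {ae muA, forall a, f (s, a) = 0%R}}.
Proof.
move=> /(seg_sum_ae_cstS (@seg_sum_ae_cst n)); apply: filterS => s fc.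
by have := ae_cst_eq0 fc; move: fc => /[swap] ->.
Qed.

End seg_sum_theory.

(** * Gibbs' inequality for Bernoulli distributions *)

Section cross_entropy.
Context {R : realType}.
Implicit Types x y : R.
Local Open Scope ring_scope.

(** This is [1 + t <= expR t] at [t = ln y - ln x], multiplied by [x]. *)
Lemma mul_ln_sub_le x y : 0 < x -> 0 < y -> x * (ln y - ln x) <= y - x.
Proof.
move=> x0 y0; have -> : y - x = x * (expR (ln y - ln x) - 1).
  rewrite expRD expRN !lnK ?posrE//.
  by field; rewrite gt_eqF.
by rewrite ler_pM2l// lerBrDl expR_ge1Dx.
Qed.

Lemma mul_ln_sub_lt x y : 0 < x -> 0 < y -> x != y ->
  x * (ln y - ln x) < y - x.
Proof.
move=> x0 y0 xy; have -> : y - x = x * (expR (ln y - ln x) - 1).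
  rewrite expRD expRN !lnK ?posrE//.
  by field; rewrite gt_eqF.
rewrite ltr_pM2l// ltrBrDl expR_gt1Dx// subr_eq0.
by apply: contra_neq xy => /ln_inj ->; rewrite ?posrE.
Qed.

Definition cross_entropy x y := x * - ln y + (1 - x) * - ln (1 - y).

Lemma cross_entropy_ge0 x y : 0 < x < 1 -> 0 < y < 1 -> 0 <= cross_entropy x y.
Proof.
move=> /andP[x0 x1] /andP[y0 y1].
have H1 : ln y <= 0 by apply: ln_le0; exact: ltW.
have H2 : ln (1 - y) <= 0 by apply: ln_le0; lra.
rewrite /cross_entropy; apply: addr_ge0; apply: mulr_ge0; lra.
Qed.

(** Comparing [x] and [1 - x] with 1 bounds the two terms by [1 - x] and [x]. This crude bound is
    enough to make expected entropies finite. *)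
Lemma entropy_le1 x : 0 < x < 1 -> cross_entropy x x <= 1.
Proof.
move=> /andP[x0 x1].
have := mul_ln_sub_le x0 ltr01.
have : 0 < 1 - x by lra.
move=> /mul_ln_sub_le => /(_ 1 ltr01).
rewrite /cross_entropy ln1; lra.
Qed.

(** The bounds [y - x] and [x - y] for the two outcomes cancel. *)
Lemma entropy_le_cross_entropy x y : 0 < x < 1 -> 0 < y < 1 ->
  cross_entropy x x <= cross_entropy x y.
Proof.
move=> /andP[x0 x1] /andP[y0 y1].
have := mul_ln_sub_le x0 y0.
have x'0 : 0 < 1 - x by lra.
have y'0 : 0 < 1 - y by lra.
have := mul_ln_sub_le x'0 y'0.
rewrite /cross_entropy; lra.
Qed.

Lemma entropy_eq_cross_entropy x y : 0 < x < 1 -> 0 < y < 1 ->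
  cross_entropy x y = cross_entropy x x -> x = y.
Proof.
move=> /andP[x0 x1] /andP[y0 y1] xy; apply/eqP; apply: contraPT xy => xy.
have := mul_ln_sub_lt x0 y0 xy.
have x'0 : 0 < 1 - x by lra.
have y'0 : 0 < 1 - y by lra.
have := mul_ln_sub_le x'0 y'0.
rewrite /cross_entropy => ? ? ?; lra.
Qed.

End cross_entropy.

Lemma measurable_cross_entropy d (T : measurableType d) (R : realType)
    (f g : T -> R) :
  measurable_fun [set: T] f -> measurable_fun [set: T] g ->
  measurable_fun [set: T] (fun x => cross_entropy (f x) (g x)).
Proof.
move=> mf mg.
have m1B (h : T -> R) : measurable_fun [set: T] h ->
  measurable_fun [set: T] (fun x => 1 - h x)%R.
  by move=> mh; exact: measurable_funB.
have mNln (h : T -> R) : measurable_fun [set: T] h ->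
    measurable_fun [set: T] (fun x => - ln (h x))%R.
  move=> mh; apply: measurable_funN.
  exact: (measurableT_comp (@measurable_ln R) mh).
by apply: measurable_funD; apply: measurable_funM; auto.
Qed.

(** The excess [D] of the cross entropy over the entropy is nonnegative with integral 0, so the
    equality case of Gibbs' inequality holds almost surely. *)
Lemma integral_cross_entropy_min d (T : measurableType d) (R : realType)
    (P : probability T R) (f g : T -> R) :
  measurable_fun [set: T] f -> measurable_fun [set: T] g ->
  (forall x, 0 < f x < 1)%R -> (forall x, 0 < g x < 1)%R ->
  \int[P]_x (cross_entropy (f x) (g x))%:E <=
    \int[P]_x (cross_entropy (f x) (f x))%:E ->
  {ae P, forall x, f x = g x}.
Proof.
move=> mf mg f01 g01.
have mfg := measurable_cross_entropy mf mg.
have mff := measurable_cross_entropy mf mf.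
pose D x := (cross_entropy (f x) (g x) - cross_entropy (f x) (f x))%R.
have mD : measurable_fun [set: T] D by exact: measurable_funB.
have D0 x : (0 <= D x)%R by rewrite subr_ge0 entropy_le_cross_entropy.
have -> : \int[P]_x (cross_entropy (f x) (g x))%:E =
    \int[P]_x (cross_entropy (f x) (f x))%:E + \int[P]_x (D x)%:E.
  rewrite -ge0_integralD//=.
  - by apply: eq_integral => x _; rewrite -EFinD addrC subrK.
  - by move=> x _; rewrite lee_fin cross_entropy_ge0.
  - exact/measurable_EFinP.
  - by move=> x _; rewrite lee_fin.
  - exact/measurable_EFinP.
(* Cancelling in the extended reals needs a finite expected entropy, which is at most the total mass
   of [P]. *)
rewrite -[leRHS]adde0 leeD2lE; last first.
  rewrite ge0_fin_numE; last first.
    by apply: integral_ge0 => x _; rewrite lee_fin cross_entropy_ge0.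
  apply: (@le_lt_trans _ _ (\int[P]_(x in [set: T]) cst 1 x)); last first.
    by rewrite integral_cst// mul1e ltey_eq fin_num_measure.
  apply: ge0_le_integral => //.
  - by move=> x _; rewrite lee_fin cross_entropy_ge0.
  - exact/measurable_EFinP.
  - by move=> x _; rewrite lee_fin entropy_le1.
move=> D0'.
have {}D0' : \int[P]_x (D x)%:E = 0.
  by apply/eqP; rewrite eq_le D0' integral_ge0// => x _; rewrite lee_fin.
have mD' : measurable_fun [set: T] (EFin \o D) by exact/measurable_EFinP.
apply: filterS (ge0_integral_eq0_ae mD' _ D0') => [x []|x]; last first.
  by rewrite lee_fin.
move=> /eqP; rewrite subr_eq0 => /eqP; exact: entropy_eq_cross_entropy.
Qed.

(** * Preference probabilities and the CPL loss *)

Section pref_prob_theory.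
Context (dS dA : measure_display) (S : measurableType dS)
  (A : measurableType dA) (R : realType).
Implicit Types (f g : S * A -> R) (gamma : R).

Lemma pref_prob_itv gamma f k (s1 s0 : k.-tuple (S * A)) :
  (0 < pref_prob gamma f s1 s0 < 1)%R.
Proof.
have e1 := expR_gt0 (seg_sum gamma f s1).
have e0 := expR_gt0 (seg_sum gamma f s0).
by rewrite /pref_prob divr_gt0 ?addr_gt0//= ltr_pdivrMr ?addr_gt0// mul1r ltrDl.
Qed.

Lemma pref_prob_swap gamma f k (s1 s0 : k.-tuple (S * A)) :
  pref_prob gamma f s0 s1 = (1 - pref_prob gamma f s1 s0)%R.
Proof.
have e1 := expR_gt0 (seg_sum gamma f s1).
have e0 := expR_gt0 (seg_sum gamma f s0).
rewrite /pref_prob; field.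
by rewrite gt_eqF ?addr_gt0.
Qed.

(** A preference probability is the logistic function of the difference of the two sums, hence
    determines it; the conclusion regroups the terms by segment. *)
Lemma pref_prob_inj gamma f g k (s1 s0 : k.-tuple (S * A)) :
  pref_prob gamma f s1 s0 = pref_prob gamma g s1 s0 ->
  (seg_sum gamma f s1 - seg_sum gamma g s1 =
   seg_sum gamma f s0 - seg_sum gamma g s0)%R.
Proof.
rewrite /pref_prob => /eqP.
have ef1 := expR_gt0 (seg_sum gamma f s1).
have ef0 := expR_gt0 (seg_sum gamma f s0).
have eg1 := expR_gt0 (seg_sum gamma g s1).
have eg0 := expR_gt0 (seg_sum gamma g s0).
rewrite eqr_div ?lt0r_neq0 ?addr_gt0// => /eqP e.
have : (expR (seg_sum gamma f s1) * expR (seg_sum gamma g s0) =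
  expR (seg_sum gamma g s1) * expR (seg_sum gamma f s0))%R.
  by apply: (addrI (expR (seg_sum gamma f s1) * expR (seg_sum gamma g s1))%R);
    rewrite -mulrDr e mulrDr [in LHS]mulrC.
rewrite -!expRD => /expR_inj; lra.
Qed.

Lemma measurable_pref_prob gamma f k : measurable_fun [set: S * A] f ->
  measurable_fun [set: k.-tuple (S * A) * k.-tuple (S * A)]
    (fun z => pref_prob gamma f z.1 z.2).
Proof.
move=> mf.
have mseg := measurable_seg_sum gamma mf (n := k).
pose Sg := (k.-tuple (S * A))%type.
have mseg1 := measurableT_comp mseg (@measurable_fst _ _ Sg Sg).
have mseg2 := measurableT_comp mseg (@measurable_snd _ _ Sg Sg).
have me h := measurableT_comp (@measurable_expR R) h.
have ml h := measurableT_comp (@measurable_ln R) h.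
have mden := measurable_funD (me _ _ _ _ mseg1) (me _ _ _ _ mseg2).
(* The quotient is written as the exponential of a sum minus the logarithm of the positive
   denominator. *)
have := me _ _ _ _ (measurable_funB mseg1 (ml _ _ _ _ mden)).
congr measurable_fun; apply/funext => z /=.
have e1 := expR_gt0 (seg_sum gamma f z.1).
have e0 := expR_gt0 (seg_sum gamma f z.2).
by rewrite expRD expRN lnK// posrE addr_gt0.
Qed.

(** The Bernoulli label is integrated out; swapping the segments turns a preference probability into
    its complement. *)
Lemma cpl_lossE gamma alpha k adv
    (rho : probability (k.-tuple (S * A) * k.-tuple (S * A))%type R) f :
  cpl_loss gamma alpha adv rho f = \int[rho]_z (cross_entropy
    (pref_prob gamma adv z.1 z.2)
    (pref_prob gamma (fun x => alpha * ln (f x)) z.1 z.2))%:E.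
Proof.
apply: eq_integral => -[s1 s0] _ /=.
have /andP[p0 p1] := pref_prob_itv gamma adv s1 s0.
have /andP[q0 q1] := pref_prob_itv gamma (fun x => alpha * ln (f x))%R s1 s0.
rewrite integral_bernoulli_prob/=; last 2 first.
- by rewrite !ltW.
- case; rewrite lee_fin oppr_ge0 ln_le0//; first exact: ltW.
  by rewrite pref_prob_swap gerBl ltW.
by rewrite [X in _ + (_ * (- ln X)%:E)]pref_prob_swap -!EFinM -EFinD.
Qed.

End pref_prob_theory.

(** * From pairs of segments to a single segment *)

Section recovery.
Context (dS dA : measure_display) (S : measurableType dS)
  (A : measurableType dA) (R : realType).
Variables (muS : {sigma_finite_measure set S -> \bar R})
  (muA : {sigma_finite_measure set A -> \bar R}) (p : R.-pker (S * A) ~> S).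

Lemma measurable_seg_ref_xsection d (Y : measurableType d) n
    (B : set (Y * n.+1.-tuple (S * A))) : measurable B ->
  measurable_fun [set: Y] (fun y => seg_ref muS muA p n.+1 (xsection B y)).
Proof.
move=> mB.
have mlaw := @measurable_seg_law _ _ _ _ _ muA p n.
apply: (measurable_seg_lawS (l := fun=> muS) mlaw) => // f f0 mf.
exact: (measurable_fun_fubini_tonelli_F (m2 := muS) f mf f0).
Qed.

(** Almost every section of the null set is null; as the reference measure is nonzero, some [sigma0]
    has a null section, and [g sigma0] is the constant. *)
Lemma ae_cst_pair n (g : n.+1.-tuple (S * A) -> R) :
  measurable_fun [set: _] g ->
  seg_ref muS muA p n.+1 [set: _] != 0 ->
  (seg_ref muS muA p n.+1 \x seg_ref muS muA p n.+1)
    [set z | g z.1 != g z.2] = 0 ->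
  exists c, seg_ref muS muA p n.+1 [set sigma | g sigma != c] = 0.
Proof.
move=> mg ref0 gneq0.
pose nu : {measure set _ -> \bar R} := seg_measure muA p muS (n := n.+1).
pose N : set (n.+1.-tuple (S * A) * n.+1.-tuple (S * A)) :=
  [set z | g z.1 != g z.2].
have mN : measurable N by apply: measurable_neq; exact: measurableT_comp.
have := ge0_integral_eq0_ae (mu := nu) (measurable_seg_ref_xsection mN) _ gneq0.
have H z : 0 <= seg_ref muS muA p n.+1 (xsection N z) by exact: seg_law_ge0.
move=> /(_ H) aeN.
have [[sigma0 Nsigma0]|noN] :=
  pselect (exists z, seg_ref muS muA p n.+1 (xsection N z) = 0).
  exists (g sigma0); rewrite -[RHS]Nsigma0; congr (seg_ref _ _ _ _ _).
  by apply/seteqP; split => z; rewrite /xsection /= inE /N /= eq_sym.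
have [N' [mN' N'0 subN']] : {ae nu, forall z, False}.
  by apply: filterS aeN => z Nz; apply: noN; exists z.
case/negP: ref0; apply/eqP.
by rewrite (_ : [set: _] = N')//; apply/seteqP; split => // z _; exact: subN'.
Qed.

(** This serves to exclude a zero reference measure, since no probability is absolutely continuous
    with respect to zero. *)
Lemma seg_ref0_product_null n : seg_ref muS muA p n [set: _] = 0 ->
  null_set (seg_ref muS muA p n \x seg_ref muS muA p n) [set: _].
Proof.
move=> ref0 B mB _.
pose nu : {measure set _ -> \bar R} := seg_measure muA p muS (n := n).
rewrite /product_measure1; apply: (@integral0_eq _ _ _ nu) => z _ /=.
apply: (subset_measure0 (mu := nu) (B := [set: _])) => //.
exact: measurable_xsection.
Qed.

End recovery.

(** * Normalization of policies *)

Section policies.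
Context (dS dA : measure_display) (S : measurableType dS)
  (A : measurableType dA) (R : realType).
Variables (muA : {sigma_finite_measure set A -> \bar R}).

(** A constant log ratio means that [pi1] is [expR (c / alpha)] times [pi2] almost everywhere;
    integrating over the actions gives [expR (c / alpha) = 1]. *)
Lemma policy_log_ratio_ae_cst_eq0 (alpha : R) (pi1 pi2 : S * A -> R) s c :
  (0 < alpha)%R -> is_policy muA pi1 -> is_policy muA pi2 ->
  {ae muA, forall a, alpha * ln (pi1 (s, a)) - alpha * ln (pi2 (s, a)) = c}%R ->
  c = 0%R.
Proof.
move=> alpha0 [mpi1 pi10 pi1T] [mpi2 pi20 pi2T] aec.
have := pi2T s; have := pi1T s.
have m1 : measurable_fun [set: A] (fun a => (pi1 (s, a))%:E).
  by apply/measurable_EFinP; exact: measurable_fun_pair2.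
have m2 : measurable_fun [set: A] (fun a => (pi2 (s, a))%:E).
  by apply/measurable_EFinP; exact: measurable_fun_pair2.
have e0 : 0 <= (expR (c / alpha))%:E by rewrite lee_fin expR_ge0.
rewrite (@ge0_ae_eq_integral _ _ _ muA _ _
  (fun a => (expR (c / alpha))%:E * (pi2 (s, a))%:E))//.
- rewrite ge0_integralZl// => [|a _]; last by rewrite lee_fin ltW.
  move=> + pi2sT; rewrite pi2sT mule1 => -[].
  rewrite -[X in _ = X -> _]expR0 => /expR_inj /eqP.
  rewrite mulf_eq0 invr_eq0 (gt_eqF alpha0) orbF => /eqP //.
- exact: measurable_funeM.
- by move=> a _; rewrite lee_fin ltW.
- by move=> a _; rewrite mule_ge0// lee_fin ltW.
apply: filterS aec => a <- _; rewrite -EFinM -mulrBr mulrAC.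
rewrite divff ?gt_eqF// mul1r.
by rewrite expRD expRN !lnK ?posrE// divfK// gt_eqF.
Qed.

Lemma mul_ln_inj (alpha x y : R) :
  (0 < alpha)%R -> (0 < x)%R -> (0 < y)%R ->
  (alpha * ln x - alpha * ln y = 0 -> x = y)%R.
Proof.
move=> alpha0 x0 y0 /eqP; rewrite subr_eq0 => /eqP /(mulfI (lt0r_neq0 alpha0)).
by apply: ln_inj; rewrite posrE.
Qed.

End policies.

Theorem theorem1 (R : realType) (dS dA : measure_display)
  (S : measurableType dS) (A : measurableType dA)
  (muS : {sigma_finite_measure set S -> \bar R})
  (muA : {sigma_finite_measure set A -> \bar R})
  (p : R.-pker (S * A) ~> S)
  (gamma : R) (hgamma : (0 < gamma < 1)%R)
  (alpha : R) (halpha : (0 < alpha)%R)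
  (rE : S * A -> R) (hrE : measurable_fun [set: S * A] rE)
  (pistar : S * A -> R)
  (hopt : is_optimal_policy muA p gamma alpha rE pistar)
  (hV : forall s, opt_value muA p gamma alpha rE s \is a fin_num)
  (hQ : forall x, opt_qvalue muA p gamma alpha rE x \is a fin_num)
  (hziebart : forall x,
     pistar x = expR (opt_advantage muA p gamma alpha rE x / alpha))
  (k : nat) (hk : (1 <= k)%N)
  (rho : probability (k.-tuple (S * A) * k.-tuple (S * A))%type R)
  (hrho_ac : rho `<< (seg_ref muS muA p k \x seg_ref muS muA p k))
  (hac_rho : (seg_ref muS muA p k \x seg_ref muS muA p k) `<< rho)
  (pihat : S * A -> R)
  (hmin : is_minimizer muA
     (cpl_loss gamma alpha (opt_advantage muA p gamma alpha rE) rho) pihat) :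
  {ae (muS \x muA), forall x, pihat x = pistar x} /\
  (finite_set [set: S] -> finite_set [set: A] ->
   (forall B : set S, measurable B) -> (forall B : set A, measurable B) ->
   (forall B : set S, muS B = counting B) ->
   (forall B : set A, muA B = counting B) ->
   forall x, pihat x = pistar x).
Proof.
have [polstar _] := hopt; have [polhat lehat] := hmin.
have [mstar star0 _] := polstar; have [mhat hat0 _] := polhat.
have gamma0 : (gamma != 0)%R by case/andP: hgamma => /lt0r_neq0.
have advE : opt_advantage muA p gamma alpha rE =
    (fun x => alpha * ln (pistar x))%R.
  by apply/funext => x; rewrite hziebart expRK mulrC divfK// gt_eqF.
have mln (pi : S * A -> R) : measurable_fun [set: _] pi ->
    measurable_fun [set: _] (fun x => alpha * ln (pi x))%R.
  move=> mpi; apply: measurable_funM => //.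
  exact: (measurableT_comp (@measurable_ln R) mpi).
pose f x := (alpha * ln (pihat x) - alpha * ln (pistar x))%R.
have mf : measurable_fun [set: _] f by apply: measurable_funB; exact: mln.
have aefstar : {ae (muS \x muA), forall x, pihat x = pistar x}.
  have prefE : {ae rho, forall z, seg_sum gamma f z.1 = seg_sum gamma f z.2}.
    (* With [pistar] as competitor and [advE], the right-hand side becomes an expected entropy, as
       [integral_cross_entropy_min] requires. *)
    have := lehat _ polstar; rewrite !cpl_lossE advE.
    move=> /(integral_cross_entropy_min _ _ _ _) aeE.
    apply: filterS (aeE _ _ _ _) => [z||||] /=.
    - move=> /esym /pref_prob_inj.
      rewrite /seg_sum -!sumrB; under eq_bigr do rewrite -mulrBr.
      by under [X in _ = X -> _]eq_bigr do rewrite -mulrBr.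
    - by apply: measurable_pref_prob; exact: mln.
    - by apply: measurable_pref_prob; exact: mln.
    - by move=> z; exact: pref_prob_itv.
    - by move=> z; exact: pref_prob_itv.
  case: k hk rho hrho_ac hac_rho {hmin lehat} prefE
    => // n _ rho rho_ac ac_rho prefE.
  have mg : measurable_fun [set: _] (seg_sum gamma f (k := n.+1)).
    exact: measurable_seg_sum.
  have [||c fc] := @ae_cst_pair _ _ _ _ _ muS muA p n _ mg.
  - apply/negP => /eqP /seg_ref0_product_null /rho_ac /(_ setT measurableT).
    by move=> /(_ (@subset_refl _ _)) /eqP; rewrite probability_setT onee_eq0.
  (* The other direction of absolute continuity: the pairs with different sums form a [rho]-null
     set, hence a null set for the reference product. *)
  - apply: (ac_rho _ (negligible_null_set prefE)).
      by apply: measurable_neq; exact: measurableT_comp.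
    by move=> z /= /eqP.
  have ae0 := seg_sum_ae_cst_eq0 mf gamma0
    (fun s c => policy_log_ratio_ae_cst_eq0 halpha polhat polstar) fc.
  have mN := measurable_neq mhat mstar.
  (* The disagreement set is null because almost every section of it is: [f (s, a) = 0] forces
     equality at [(s, a)]. *)
  exists [set x | pihat x != pistar x]; split => //.
    apply: ae_xsection0_product_measure1 => //.
    apply: filterS ae0 => s aes; apply: measure_negligible.
      exact: measurable_xsection.
    apply: negligibleS aes => a; rewrite /xsection /= inE /= => /eqP.
    apply: contra_not; exact: mul_ln_inj.
  by move=> x /= /eqP.
split => // _ _ mS mA countS countA [s a].
have [N [mN N0 subN]] := aefstar.
(* A point of disagreement would lie in the null set [N], while under counting measures its
   singleton has mass 1. *)
apply: contrapT => /subN Nsa.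
have : (muS \x muA) ([set s] `*` [set a]) = 0.
  apply: (subset_measure0 (B := N)) => //.
    exact: measurableX.
  by move=> [? ?] /= [-> ->].
have -> : (muS \x muA) ([set s] `*` [set a]) = muS [set s] * muA [set a].
  exact: product_measure1E.
have -> : muS [set s] = 1.
  by rewrite countS /counting asboolT// fset_set1 finmap.cardfs1.
have -> : muA [set a] = 1.
  by rewrite countA /counting asboolT// fset_set1 finmap.cardfs1.
by rewrite mule1 => /eqP; rewrite onee_eq0.
Qed.
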